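(* Let $Q\in\mathbb{R}^{d\times d}$ be skew-symmetric, $M\in\mathbb{R}^{d\times d}$ symmetric, $A=QM$, and let $U:\mathbb{R}^d\to\mathbb{R}$ be a homogeneous cubic polynomial. Set $f=Q\nabla U$, and consider the Hamiltonian system $\dot x=Ax+f(x)$. Let $x_n,x_{n+1}\in\mathbb{R}^d$ satisfy the EKahan scheme with step size $h$, $$x_{n+1}=e^{hA}x_n+h\,\phi(hA)\Bigl(-\tfrac12 f(x_n)+2f\bigl(\tfrac{x_n+x_{n+1}}{2}\bigr)-\tfrac12 f(x_{n+1})\Bigr).$$ Then $$H_{n+1}-H_n=U(x_{n+1}-x_n),$$ where $H_n=\frac12 x_n^{\mathsf T}Mx_n+U(x_n)$ is the discrete energy at $t=t_n$ (and $H_{n+1}$ is defined likewise from $x_{n+1}$).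
   Context: $\phi(z)=\frac{e^z-1}{z}$ (entire function, $\phi(0)=1$), applied to matrices through its power series. The system is $\dot x=Q\nabla H(x)$ with $H(x)=\frac12x^{\mathsf T}Mx+U(x)$. *)

(* Defs.v *)
From HB Require Import structures.
From mathcomp Require Import all_boot all_order all_algebra.
From mathcomp Require Import all_classical all_reals all_analysis.
From mathcomp Require Import -(notations) mpoly.

Set Implicit Arguments.
Unset Strict Implicit.
Unset Printing Implicit Defensive.

Import Order.TTheory GRing.Theory Num.Theory.
Import numFieldNormedType.Exports.

Local Open Scope classical_set_scope.
Local Open Scope ring_scope.

(** The zero polynomial counts as homogeneous, following [ishomog1]. *)
Definition homogeneous_cubic (R : realType) (d : nat)
    (U : 'cV[R]_d -> R) : Prop :=
  exists2 p : mpoly d R,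
    p \is ishomog1 3 (@mdeg d) &
    forall x : 'cV[R]_d, U x = meval (fun i => x i 0) p.

Definition grad (R : realType) (d : nat) (U : 'cV[R]_d -> R)
    (x : 'cV[R]_d) : 'cV[R]_d :=
  \col_i 'D_(delta_mx i 0) U x.

(** [limn] has a default value on divergent sequences; [mx_exp_cvg] and
    [mx_phi_cvg] show that it is not reached by the two series used below. *)
Definition mx_pseries (R : realType) (d : nat) (c : R^nat)
    (A : 'M[R]_d) : 'M[R]_d :=
  limn (series (fun k => c k *: A ^+ k)).

Lemma mx_norm_mul (R : realType) (d : nat) (A B : 'M[R]_d) :
  `|A *m B| <= d%:R * `|A| * `|B|.
Proof.
rewrite {1}/Num.norm /= mx_normrE; apply/bigmax_leP; split => [|[i j] _].
  by rewrite !mulr_ge0.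
rewrite mxE (le_trans (ler_norm_sum _ _ _))//.
rewrite -[d in d%:R]card_ord -mulrA mulr_natl -sumr_const ler_sum// => k _.
by rewrite normrM ler_pM// {2}/Num.norm /= mx_normrE;
  [apply: (le_bigmax _ (fun ij => `|A ij.1 ij.2|) (i, k))
  |apply: (le_bigmax _ (fun ij => `|B ij.1 ij.2|) (k, j))].
Qed.

Lemma mx_pseries_cvg (R : realType) (d : nat) (c : R^nat) (A : 'M[R]_d) :
  (forall k, `|c k| <= k`!%:R^-1) ->
  cvgn (series (fun k => c k *: A ^+ k)).
Proof.
move=> ck; set r := d%:R * `|A|.
have r0 : 0 <= r by rewrite mulr_ge0.
have Ar k : `|A ^+ k| <= `|1 : 'M[R]_d| * r ^+ k.
  elim: k => [|k IH]; first by rewrite !expr0 mulr1.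
  rewrite exprS (le_trans (mx_norm_mul _ _))// -/r exprS mulrCA.
  by rewrite ler_wpM2l.
suff /cauchy_cvgP/cauchy_seriesP nc :
    cvgn (series (fun k => `|c k *: A ^+ k|)).
  apply: mx_complete; apply/cauchy_seriesP => e /nc.
  apply: filterS => n /=; rewrite ger0_norm ?sumr_ge0//.
  by apply: le_lt_trans; apply: ler_norm_sum.
apply: (@series_le_cvg _ _ (fun k => `|1 : 'M[R]_d| * exp_coeff r k)).
- by move=> k /=.
- by move=> k; rewrite mulr_ge0// exp_coeff_ge0.
- move=> k /=; rewrite normrZ /exp_coeff /= mulrA mulrC.
  by rewrite ler_pM.
- have -> : series (fun k => `|1 : 'M[R]_d| * exp_coeff r k) =
    `|1 : 'M[R]_d| \*: series (exp_coeff r).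
    by apply/funext => n; rewrite /series /= -mulr_sumr.
  by apply: is_cvgZr; exact: is_cvg_series_exp_coeff.
Qed.

Definition mx_exp (R : realType) (d : nat) (A : 'M[R]_d) : 'M[R]_d :=
  mx_pseries (fun k => k`!%:R^-1) A.

Lemma mx_exp_cvg (R : realType) (d : nat) (A : 'M[R]_d) :
  series (fun k => k`!%:R^-1 *: A ^+ k) @ \oo --> mx_exp A.
Proof. by apply: mx_pseries_cvg => k; rewrite ger0_norm. Qed.

Definition phi (R : realType) (z : R) : R :=
  if z == 0 then 1 else (expR z - 1) / z.

(** Taylor coefficients of [phi] at the origin, see [phi_pseries]. *)
Definition phi_coeff (R : realType) : R^nat := fun k => (k.+1)`!%:R^-1.

Lemma phi_pseries (R : realType) (z : R) :
  series (fun k => phi_coeff R k * z ^+ k) @ \oo --> phi z.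
Proof.
rewrite /phi; case: eqVneq => [->|z0].
  apply: cvg_near_cst; near=> n; rewrite /series /=.
  have n0 : (0 < n)%N by near: n; exists 1%N.
  rewrite big_ltn// expr0 mulr1 /phi_coeff factS fact0 muln1 invr1.
  rewrite big_nat_cond big1 ?addr0// => i /andP[/andP[i0 _] _].
  by rewrite expr0n gtn_eqF// mulr0.
have -> : series (fun k => phi_coeff R k * z ^+ k) =
    (fun n => (series (exp_coeff z) n.+1 - 1) / z).
  apply/funext => n; rewrite /series /= big_nat_recl// /exp_coeff /=.
  rewrite expr0 fact0 divr1 addrAC subrr add0r mulr_suml.
  apply: eq_bigr => i _; rewrite /phi_coeff exprS.
  by rewrite [z * _]mulrC mulrAC mulfK// mulrC.
apply: cvgMl; apply: cvgB; last exact: cvg_cst.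
have := @is_cvg_series_exp_coeff R z.
by rewrite -(cvg_shiftS (series (exp_coeff z))).
Unshelve. all: by end_near. Qed.

Definition mx_phi (R : realType) (d : nat) (A : 'M[R]_d) : 'M[R]_d :=
  mx_pseries (@phi_coeff R) A.

Lemma mx_phi_cvg (R : realType) (d : nat) (A : 'M[R]_d) :
  series (fun k => phi_coeff R k *: A ^+ k) @ \oo --> mx_phi A.
Proof.
apply: mx_pseries_cvg => k; rewrite /phi_coeff ger0_norm// lef_pV2 ?posrE.
- by rewrite ler_nat factS leq_pmull.
- by rewrite ltr0n fact_gt0.
- by rewrite ltr0n fact_gt0.
Qed.

Definition hamiltonian (R : realType) (d : nat) (M : 'M[R]_d)
    (U : 'cV[R]_d -> R) (x : 'cV[R]_d) : R :=
  2^-1 * (x^T *m M *m x) 0 0 + U x.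

(* Main.v *)
Require Import Defs.
From mathcomp Require Import all_boot all_order all_algebra.
From mathcomp Require Import all_classical all_reals all_analysis.
From mathcomp Require Import -(notations) mpoly.
From mathcomp Require Import ring lra.
Import Order.TTheory GRing.Theory Num.Theory.
Import numFieldNormedType.Exports.

(** Let [g] be the combination of gradients of [U] in the scheme, without its
    factor [Q], and put [B = h Q M] and [S = h phi(B) Q].  Since
    [e^B - 1 = phi(B) B], one step of the scheme is the increment
    [D = x' - x = S (M x + g)].

    The quadratic part of the energy.  Skewness of [Q] and symmetry of [M] give
    [S^T = - h phi(-B) Q], so the identity [phi(-z) e^z = phi(z)], evaluated at
    [B], turns [S^T M S] into [- (S + S^T)] ([etd_matrix_identity]).  Hence
    [D^T M D = - 2 D^T (M x + g)], and the quadratic energy grows by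
    [D^T M x + D^T M D / 2 = - D^T g] ([quadratic_energy_increment]).

    The cubic part of the energy.  Along the segment from [x] to [x'], [U] is
    [t |-> u0 + a t + b t^2 + c t^3] for [t] in [-1/2, 1/2], counted from the
    midpoint, with [c = U(D)].  Then [U x' - U x = a + c / 4], while the weights
    [-1/2, 2, -1/2] of the scheme give
    [D^T g = 2 a - ((a - b + 3 c / 4) + (a + b + 3 c / 4)) / 2 = a - 3 c / 4].
    Hence [U x' - U x = D^T g + U(D)].  This relation is linear in [U] and its
    gradient, so it is enough to check it on products of three coordinates
    ([kahan_increment_monomial]).  Adding both parts, [D^T g] cancels.

    The identity [phi(-z) e^z = phi(z)] is transferred to matrices by
    multiplying power series ([mx_pseries_mul]). *)

Set Implicit Arguments.
Unset Strict Implicit.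
Unset Printing Implicit Defensive.

Local Open Scope ring_scope.

(** * Products of matrix power series *)

(** What a product of two partial sums contains beyond the partial sum of the
    Cauchy product.  Shared by the matrix series and by the scalar series that
    dominates it. *)
Lemma sum_square_sub_triangle (V : zmodType) (G : nat -> nat -> V) (n : nat) :
  \sum_(0 <= i < n) \sum_(0 <= j < n) G i j
    - \sum_(0 <= k < n) \sum_(0 <= i < k.+1) G i (k - i)%N
  = \sum_(0 <= i < n) \sum_(0 <= j < n | (n <= i + j)%N) G i j.
Proof.
have -> : \sum_(0 <= k < n) \sum_(0 <= i < k.+1) G i (k - i)%N =
    \sum_(0 <= i < n) \sum_(0 <= j < n | ~~ (n <= i + j)%N) G i j.
  under eq_big_nat => k /andP[_ kn].
    rewrite (big_nat_widen _ _ _ _ _ kn) /=; over.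
  rewrite (exchange_big_dep_nat xpredT)//=.
  apply: eq_big_nat => i /andP[_ lin].
  (* At fixed [i], substitute [j = k - i]. *)
  rewrite (eq_bigl (fun k => true && (i <= k)%N))//.
  rewrite -(big_nat_widenl _ _ _ (fun=> true))// -{1}(add0n i) big_addn.
  rewrite (big_nat_widen _ (n - i) n) ?leq_subr//=.
  by apply: eq_big => j; rewrite ?addnK// -ltnNge ltn_subRL.
rewrite -sumrB; apply: eq_bigr => i _.
by rewrite (bigID (fun j => (n <= i + j)%N))/= addrK.
Qed.

Section matrix_power_series.
Local Open Scope classical_set_scope.
Context {R : realType} {d : nat}.
Implicit Types A B : 'M[R]_d.

Lemma cvg_mx (m n : nat) (F : nat -> 'M[R]_(m, n)) (L : 'M[R]_(m, n)) :
  (forall i j, (fun k => F k i j) @ \oo --> L i j) -> F @ \oo --> L.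
Proof.
move=> FL; apply/cvgrPdist_lt => e e0.
have : \forall k \near \oo, forall ij : 'I_m * 'I_n,
    `|L ij.1 ij.2 - F k ij.1 ij.2| < e.
  by apply: filter_forall => -[i j]; move/cvgrPdist_lt : (FL i j); apply.
apply: filterS => k Fk.
rewrite {1}/Num.norm /= mx_normrE; apply/bigmax_ltP; split=> // ij _.
by rewrite !mxE.
Qed.

Lemma cvg_mxentry (m n : nat) (F : nat -> 'M[R]_(m, n)) (L : 'M[R]_(m, n)) i j :
  F @ \oo --> L -> (fun k => F k i j) @ \oo --> L i j.
Proof.
move=> FL; apply: (cvg_comp F (fun M : 'M[R]_(m, n) => M i j)); first exact: FL.
exact: coord_continuous.
Qed.

Lemma cvg_mulmx (m n p : nat) (F : nat -> 'M[R]_(m, n)) (G : nat -> 'M[R]_(n, p))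
    (K : 'M[R]_(m, n)) (L : 'M[R]_(n, p)) :
  F @ \oo --> K -> G @ \oo --> L -> (fun k => F k *m G k) @ \oo --> K *m L.
Proof.
move=> FK GL; apply: cvg_mx => i j.
under eq_fun do rewrite mxE.
rewrite mxE; apply: cvg_big => [|l _]; first exact: add_continuous.
by apply: cvgM; exact: cvg_mxentry.
Qed.

Lemma cvg_trmx (m n : nat) (F : nat -> 'M[R]_(m, n)) (L : 'M[R]_(m, n)) :
  F @ \oo --> L -> (fun k => (F k)^T) @ \oo --> L^T.
Proof.
move=> FL; apply: cvg_mx => i j; under eq_fun do rewrite mxE.
by rewrite mxE; exact: cvg_mxentry.
Qed.

Lemma norm_mxX_le A k : `|A ^+ k| <= `|1 : 'M[R]_d| * (d%:R * `|A|) ^+ k.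
Proof.
elim: k => [|k IH]; first by rewrite !expr0 mulr1.
rewrite exprS (le_trans (mx_norm_mul _ _))// exprS mulrCA.
by rewrite ler_wpM2l// mulr_ge0.
Qed.

Definition cauchy_product (a b : R^nat) : R^nat :=
  fun k => \sum_(0 <= i < k.+1) a i * b (k - i)%N.

(** The error between the product of the partial sums and the partial sum of the
    Cauchy product is bounded, term by term, by the same error for the square of
    the scalar exponential series at [r = d |A|]; the latter error tends to
    [e^r e^r - e^(r + r) = 0]. *)
Lemma mx_pseries_mul (a b : R^nat) A :
  (forall k, `|a k| <= k`!%:R^-1) -> (forall k, `|b k| <= k`!%:R^-1) ->
  series (fun k => cauchy_product a b k *: A ^+ k) @ \oo
    --> mx_pseries a A *m mx_pseries b A.
Proof.
move=> a1 b1; set r := d%:R * `|A|; set e := exp_coeff r.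
have r0 : 0 <= r by rewrite mulr_ge0.
pose P n := series (fun k => a k *: A ^+ k) n *m series (fun k => b k *: A ^+ k) n.
pose C := series (fun k => cauchy_product a b k *: A ^+ k).
have PL : P @ \oo --> mx_pseries a A *m mx_pseries b A.
  by apply: cvg_mulmx; exact: mx_pseries_cvg.
pose G i j := (a i * b j) *: A ^+ (i + j).
have PC n : P n - C n = \sum_(0 <= i < n) \sum_(0 <= j < n | (n <= i + j)%N) G i j.
  rewrite -sum_square_sub_triangle; congr (_ - _).
    rewrite /P /series /= mulmx_suml; apply: eq_bigr => i _.
    rewrite mulmx_sumr; apply: eq_bigr => j _.
    by rewrite -scalemxAl -scalemxAr scalerA /G exprD.
  rewrite /C /series /=; apply: eq_bigr => k _.
  rewrite /cauchy_product scaler_suml; apply: eq_big_nat => i /andP[_ ik].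
  by rewrite /G subnKC.
pose T n := series e n * series e n - series (exp_coeff (r + r)) n.
have TE n : T n = \sum_(0 <= i < n) \sum_(0 <= j < n | (n <= i + j)%N) e i * e j.
  rewrite -sum_square_sub_triangle; congr (_ - _).
    rewrite /series /= mulr_suml; apply: eq_bigr => i _.
    by rewrite mulr_sumr.
  rewrite /series /=; apply: eq_bigr => k _.
  rewrite /exp_coeff /= exprDn mulr_suml big_mkord; apply: eq_bigr => i _.
  have ik : (i <= k)%N by rewrite -ltnS.
  rewrite -(bin_fact ik) -mulr_natr !natrM /e /exp_coeff /=.
  have ci0 : ('C(k, i)%:R : R) != 0 by rewrite pnatr_eq0 -lt0n bin_gt0.
  have fi0 n' : (n'`!%:R : R) != 0 by rewrite pnatr_eq0 -lt0n fact_gt0.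
  by field; rewrite ci0 !fi0.
have T_to0 : T @ \oo --> (0 : R).
  have <- : expR r * expR r - expR (r + r) = 0 by rewrite expRD subrr.
  apply: cvgB; first apply: cvgM; exact: is_cvg_series_exp_coeff.
have PC_to0 : (fun n => P n - C n) @ \oo --> (0 : 'M[R]_d).
  apply/norm_cvg0P.
  apply: (@squeeze_cvgr _ _ _ _ (cst 0) (fun n => `|1 : 'M[R]_d| * T n)).
  - near=> n; rewrite normr_ge0 /= PC TE mulr_sumr.
    rewrite (le_trans (ler_norm_sum _ _ _))// ler_sum// => i _.
    rewrite (le_trans (ler_norm_sum _ _ _))// mulr_sumr ler_sum// => j _.
    rewrite /G normrZ normrM mulrC.
    have -> : `|1 : 'M[R]_d| * (e i * e j) =
        `|1 : 'M[R]_d| * r ^+ (i + j) * (i`!%:R^-1 * j`!%:R^-1).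
      by rewrite /e /exp_coeff /= exprD; ring.
    by rewrite ler_pM ?mulr_ge0 ?norm_mxX_le// ler_pM.
  - exact: cvg_cst.
  - by rewrite -(mulr0 `|1 : 'M[R]_d|); apply: cvgM => //; exact: cvg_cst.
change (C @ \oo --> mx_pseries a A *m mx_pseries b A).
have -> : C = (fun n => P n - (P n - C n)) by apply/funext => n; rewrite subKr.
by rewrite -[X in _ --> X]subr0; exact: cvgB.
Unshelve. all: by end_near. Qed.

Lemma cvg_mx_unique (F : nat -> 'M[R]_d) A B :
  F @ \oo --> A -> F @ \oo --> B -> A = B.
Proof. by move=> FA FB; apply: (cvg_unique _ FA FB); exact: norm_hausdorff. Qed.

Lemma inv_fact_decr k : (k.+1)`!%:R^-1 <= k`!%:R^-1 :> R.
Proof. by rewrite lef_pV2 ?posrE ?ltr0n ?fact_gt0// ler_nat factS leq_pmull. Qed.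

(** * The exponential and the function phi of a matrix *)

Lemma mx_phi_opp_cvg A : series (fun k => ((-1) ^+ k * phi_coeff R k) *: A ^+ k) @ \oo
  --> mx_phi (- A).
Proof.
have -> : (fun k => ((-1) ^+ k * phi_coeff R k) *: A ^+ k)
    = (fun k => phi_coeff R k *: (- A) ^+ k).
  apply/funext => k; rewrite mulrC -scalerA; congr (_ *: _).
  elim: k => [|k IH]; first by rewrite !expr0 scale1r.
  by rewrite !exprS -IH mulN1r scaleNr mulNr scalemxAr.
exact: mx_phi_cvg.
Qed.

(** [phi(-z) e^z = phi(z)] on Taylor coefficients: multiplied by [(k+1)!], it is
    the expansion of [(1 - 1)^(k+1) = 0] without its first term. *)
Lemma cauchy_product_phiN_exp (k : nat) :
  cauchy_product (fun k => (-1) ^+ k * phi_coeff R k) (fun k => k`!%:R^-1) k = phi_coeff R k.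
Proof.
rewrite /cauchy_product /phi_coeff big_mkord.
have fi0 n' : (n'`!%:R : R) != 0 by rewrite pnatr_eq0 -lt0n fact_gt0.
have := exprDn (1 : R) (- 1) k.+1.
rewrite subrr expr0n /= big_ord_recl expr0 expr1n mulr1 bin0 mulr1n => /esym/eqP.
rewrite addr_eq0 => /eqP E.
rewrite -[RHS]mul1r [X in _ = X * _]E -sumrN mulr_suml; apply: eq_bigr => i _.
rewrite expr1n mul1r lift0 exprS mulN1r mulNrn opprK.
have ik : (i.+1 <= k.+1)%N by rewrite ltn_ord.
rewrite -(bin_fact ik) subSS [('C(_, _) * _)%:R]natrM [(_`! * _)%:R]natrM -mulr_natr.
have ci0 : ('C(k.+1, i.+1)%:R : R) != 0 by rewrite pnatr_eq0 -lt0n bin_gt0.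
by field; rewrite ci0 !fi0.
Qed.

Lemma mx_phiN_mul_exp A : mx_phi (- A) *m mx_exp A = mx_phi A.
Proof.
have H : series (fun k => phi_coeff R k *: A ^+ k) @ \oo
    --> mx_pseries (fun k => (-1) ^+ k * phi_coeff R k) A *m mx_exp A.
  under eq_fun do rewrite -cauchy_product_phiN_exp.
  apply: mx_pseries_mul => k.
    by rewrite normrM normr_sign mul1r /phi_coeff ger0_norm ?inv_fact_decr.
  by rewrite ger0_norm.
rewrite -(cvg_mx_unique H (@mx_phi_cvg _ _ A)); congr (_ *m _).
by apply: (cvg_mx_unique (@mx_phi_opp_cvg A)); apply: mx_pseries_cvg => k;
  rewrite normrM normr_sign mul1r /phi_coeff ger0_norm ?inv_fact_decr.
Qed.

(** [e^z = 1 + phi(z) z]: the two series differ by a shift of the index. *)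
Lemma mx_expE A : mx_exp A = 1 + mx_phi A *m A.
Proof.
apply: (cvg_mx_unique (F := fun n => series (fun k => k`!%:R^-1 *: A ^+ k) n.+1)).
  by rewrite (cvg_shiftS (series (fun k => k`!%:R^-1 *: A ^+ k))); exact: mx_exp_cvg.
have -> : (fun n => series (fun k => k`!%:R^-1 *: A ^+ k) n.+1) =
    (fun n => 1 + series (fun k => phi_coeff R k *: A ^+ k) n *m A).
  apply/funext => n; rewrite /series /= big_nat_recl// expr0 fact0 invr1 scale1r.
  by rewrite mulmx_suml; congr (_ + _); apply: eq_bigr => k _; rewrite -scalemxAl exprSr.
apply: cvgD; first exact: cvg_cst.
by apply: cvg_mulmx; [exact: mx_phi_cvg|exact: cvg_cst].
Qed.

Lemma trmx_mx_phi A : (mx_phi A)^T = mx_phi A^T.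
Proof.
apply: (cvg_mx_unique (cvg_trmx (@mx_phi_cvg _ _ A))).
have -> : (fun n => (series (fun k => phi_coeff R k *: A ^+ k) n)^T) =
    series (fun k => phi_coeff R k *: A^T ^+ k).
  apply/funext => n; rewrite /series /= raddf_sum; apply: eq_bigr => k _ /=.
  rewrite linearZ /=; congr (_ *: _).
  by elim: k => [|k IH]; rewrite ?expr0 ?trmx1// exprS trmx_mul IH exprSr.
exact: mx_phi_cvg.
Qed.

(** Holds already for powers, since [A (B A)^k = (A B)^k A]. *)
Lemma mx_phi_swap A B : A *m mx_phi (B *m A) = mx_phi (A *m B) *m A.
Proof.
apply: (cvg_mx_unique (cvg_mulmx (cvg_cst A) (@mx_phi_cvg _ _ (B *m A)))).
have -> : (fun n => A *m series (fun k => phi_coeff R k *: (B *m A) ^+ k) n) =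
    (fun n => series (fun k => phi_coeff R k *: (A *m B) ^+ k) n *m A).
  apply/funext => n; rewrite /series /= mulmx_sumr mulmx_suml; apply: eq_bigr => k _.
  rewrite -scalemxAl -scalemxAr; congr (_ *: _).
  elim: k => [|k IH]; first by rewrite !expr0 mulmx1 mul1mx.
  by rewrite !exprS -!mulmxA -IH !mulmxA.
by apply: cvg_mulmx; [exact: mx_phi_cvg|exact: cvg_cst].
Qed.

(** With [B = h Q M], swapping the factors in the transpose gives
    [S^T = - h phi(-B) Q], so [S^T M S = - h (phi(-B) B phi(B)) Q]; and
    [phi(-B) B phi(B) = phi(-B) (e^B - 1) = phi(B) - phi(-B)]. *)
Lemma etd_matrix_identity (h : R) (Q M : 'M[R]_d) :
  Q^T = - Q -> M^T = M ->
  let S := h *: (mx_phi (h *: (Q *m M)) *m Q) in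
  S^T *m M *m S = - (S + S^T).
Proof.
move=> QT MT S; set B := h *: (Q *m M).
have ST : S^T = - (h *: (mx_phi (- B) *m Q)).
  rewrite /S linearZ /= trmx_mul trmx_mx_phi QT linearZ /= trmx_mul QT MT.
  have -> : h *: (M *m - Q) = (- h *: M) *m Q.
    by rewrite mulmxN scalerN -scalemxAl scaleNr.
  rewrite mulNmx mx_phi_swap -scalemxAr scaleNr.
  by rewrite scalerN.
have BE : mx_phi (- B) *m (mx_phi B *m B) = mx_phi B - mx_phi (- B).
  have -> : mx_phi B *m B = mx_exp B - 1 by rewrite mx_expE addrC addKr.
  by rewrite mulmxBr mx_phiN_mul_exp mulmx1.
have BC : B *m mx_phi B = mx_phi B *m B.
  by have := mx_phi_swap B 1%:M; rewrite mul1mx mulmx1.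
transitivity (- (h *: ((mx_phi B - mx_phi (- B)) *m Q))); last first.
  by rewrite ST /S mulmxBl scalerBr.
rewrite -BE -BC ST /S !mulNmx; congr (- _).
move: (mx_phi B) (mx_phi (- B)) => P N; rewrite /B.
by rewrite !(=^~ scalemxAl, =^~ scalemxAr) !mulmxA.
Qed.

End matrix_power_series.

(** * The quadratic part of the energy *)

(** With [v = M x + g], the hypothesis on [S] says [D^T M D = - 2 D^T v]; hence
    the increment [D^T M x + D^T M D / 2] is [D^T (M x - v)]. *)
Lemma quadratic_energy_increment (R : realFieldType) (d : nat) (M S : 'M[R]_d)
    (x g : 'cV[R]_d) :
  M^T = M -> S^T *m M *m S = - (S + S^T) ->
  let D := S *m (M *m x + g) in
  2^-1 * ((x + D)^T *m M *m (x + D)) 0 0 - 2^-1 * (x^T *m M *m x) 0 0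
    = - (D^T *m g) 0 0.
Proof.
move=> MT SE; set v := M *m x + g; move=> D.
have tr11 (A : 'M[R]_1) : A^T 0 0 = A 0 0 by rewrite mxE.
have DD : (D^T *m M *m D) 0 0 = - (2 * (D^T *m v) 0 0).
  have -> : D^T *m M *m D = v^T *m (S^T *m M *m S) *m v.
    by rewrite /D trmx_mul !mulmxA.
  rewrite SE mulmxN mulNmx (mulmxDr v^T) mulmxDl.
  have -> : v^T *m S *m v = (D^T *m v)^T by rewrite /D trmx_mul trmxK mulmxA.
  have -> : v^T *m S^T = D^T by rewrite /D trmx_mul.
  by rewrite 2!mxE tr11; ring.
have xMD : (x^T *m M *m D) 0 0 = (D^T *m (M *m x)) 0 0.
  by rewrite -tr11 !trmx_mul trmxK MT.
have Dv : (D^T *m v) 0 0 = (D^T *m (M *m x)) 0 0 + (D^T *m g) 0 0.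
  by rewrite /v mulmxDr mxE.
have -> : ((x + D)^T *m M *m (x + D)) 0 0
    = (x^T *m M *m x) 0 0 + 2 * (D^T *m (M *m x)) 0 0 + (D^T *m M *m D) 0 0.
  clear DD Dv; clearbody D; rewrite [(x + D)^T]linearD /= !(mulmxDl, mulmxDr).
  rewrite [LHS]mxE [X in X + _]mxE [X in _ + X]mxE xMD -(mulmxA D^T M x).
  by ring.
by rewrite DD Dv; field.
Qed.

(** * The cubic part of the energy *)

Definition kahan_gradient (R : realType) (d : nat) (G : 'cV[R]_d -> 'cV[R]_d)
    (x x' : 'cV[R]_d) : 'cV[R]_d :=
  - (2^-1 *: G x) + 2 *: G (2^-1 *: (x + x')) - 2^-1 *: G x'.

(** Stated with a candidate gradient [G] so that both conjuncts are linear in the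
    pair [(U, G)]. *)
Definition kahan_increment (R : realType) (d : nat)
    (U : 'cV[R]_d -> R) (G : 'cV[R]_d -> 'cV[R]_d) : Prop :=
  (forall y i, is_derive y (delta_mx i 0) U (G y i 0)) /\
  forall x x', U x' - U x = ((x' - x)^T *m kahan_gradient G x x') 0 0 + U (x' - x).

Lemma is_derive_entry (R : realType) (d : nat) (y v : 'cV[R]_d) (i : 'I_d) :
  is_derive y v (fun z : 'cV[R]_d => z i 0) (v i 0).
Proof.
apply: DeriveDef; first exact/diff_derivable/differentiable_coord.
by have /matrixP/(_ i 0) := derive_mx (@derivable_id _ _ y v); rewrite derive_id mxE.
Qed.

Lemma kahan_increment_monomial (R : realType) (d : nat) (i j k : 'I_d) :
  kahan_increment (fun y : 'cV[R]_d => y i 0 * y j 0 * y k 0)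
    (fun y => (y j 0 * y k 0) *: delta_mx i 0 + (y i 0 * y k 0) *: delta_mx j 0
      + (y i 0 * y j 0) *: delta_mx k 0).
Proof.
split=> [y l|x x'].
  apply: is_derive_eq.
    apply: (is_deriveM (is_deriveM (is_derive_entry y _ i)
      (is_derive_entry y _ j)) (is_derive_entry y _ k)).
  rewrite !mxE !eqxx !andbT /GRing.scale /=.
  rewrite [(_ * _) y]/GRing.mul /=.
  by rewrite [l == i]eq_sym [l == j]eq_sym [l == k]eq_sym /=; ring.
(* [coef p q] is the scheme's average of the quadratic function
   [y |-> y_p * y_q], which is the form of the gradient entries. *)
pose coef (p q : 'I_d) := - (2^-1 * (x p 0 * x q 0))
  + 2 * (2^-1 * (x p 0 + x' p 0) * (2^-1 * (x q 0 + x' q 0)))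
  - 2^-1 * (x' p 0 * x' q 0).
have -> : kahan_gradient (fun y : 'cV[R]_d => (y j 0 * y k 0) *: delta_mx i 0
      + (y i 0 * y k 0) *: delta_mx j 0 + (y i 0 * y j 0) *: delta_mx k 0) x x' =
    coef j k *: delta_mx i 0 + coef i k *: delta_mx j 0 + coef i j *: delta_mx k 0.
  by apply/colP => l; rewrite /coef !mxE; ring.
rewrite !mulmxDr -!scalemxAr -!colE /coef !mxE.
by field.
Qed.

Lemma kahan_incrementD (R : realType) (d : nat) (U1 U2 : 'cV[R]_d -> R) G1 G2 :
  kahan_increment U1 G1 -> kahan_increment U2 G2 ->
  kahan_increment (fun y => U1 y + U2 y) (fun y => G1 y + G2 y).
Proof.
move=> [D1 E1] [D2 E2]; split=> [y i|x x'].
  by rewrite mxE; exact: is_deriveD.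
have -> : kahan_gradient (fun y => G1 y + G2 y) x x' =
    kahan_gradient G1 x x' + kahan_gradient G2 x x'.
  by rewrite /kahan_gradient; apply/colP => i; rewrite !mxE; ring.
rewrite mulmxDr mxE.
move: (E1 x x') (E2 x x'); lra.
Qed.

Lemma kahan_incrementZ (R : realType) (d : nat) c (U : 'cV[R]_d -> R) G :
  kahan_increment U G -> kahan_increment (fun y => c * U y) (fun y => c *: G y).
Proof.
move=> [D1 E1]; split=> [y i|x x'].
  by rewrite mxE; exact: is_deriveZ.
have -> : kahan_gradient (fun y => c *: G y) x x' = c *: kahan_gradient G x x'.
  by rewrite /kahan_gradient; apply/colP => i; rewrite !mxE; ring.
by rewrite -scalemxAr mxE -mulrBr E1 mulrDr.
Qed.

(** Used three times to write a monomial of degree 3 as a product of three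
    variables. *)
Lemma mdegS_factor (d : nat) (m : multinom d) n : mdeg m = n.+1 ->
  exists i : 'I_d, exists2 m' : multinom d, m = mnm_add (mnm1 i) m' & mdeg m' = n.
Proof.
move=> mn.
have [i mi] : exists i, m i != 0%N.
  apply/existsP; apply: contra_eqT mn; rewrite negb_exists => /forallP m0.
  by rewrite mdegE big1// => i _; apply/eqP; rewrite -[_ == _]negbK m0.
have e : m = mnm_add (mnm1 i) (mnm_sub m (mnm1 i)).
  by rewrite addmC submK// lep1mP.
exists i; exists (mnm_sub m (mnm1 i)) => //.
by move: mn; rewrite {1}e mdegD mdeg1 => -[].
Qed.

Lemma kahan_increment_sum (R : realType) (d : nat) (I : eqType) (s : seq I)
    (F : I -> 'cV[R]_d -> R) :
  {in s, forall m, exists G, kahan_increment (F m) G} ->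
  exists G, kahan_increment (fun y => \sum_(m <- s) F m y) G.
Proof.
elim: s => [_|m s IH Fs].
  exists (fun=> 0); under eq_fun do rewrite big_nil.
  split=> [y i|x x']; first by rewrite mxE; exact: is_derive_cst.
  have -> : kahan_gradient (fun=> 0) x x' = 0 by apply/colP => i; rewrite !mxE; ring.
  by rewrite mulmx0 mxE subrr addr0.
have [G1 FG1] := Fs m (mem_head m s).
have [G2 FG2] : exists G, kahan_increment (fun y => \sum_(m <- s) F m y) G.
  by apply: IH => m' sm'; apply: Fs; rewrite inE sm' orbT.
exists (fun y => G1 y + G2 y); under eq_fun do rewrite big_cons.
exact: kahan_incrementD.
Qed.

Lemma prodX_mnm1D (R : comRingType) (d : nat) (v : 'I_d -> R) i (m : multinom d) :
  \prod_(l < d) v l ^+ (mnm_add (mnm1 i) m) l = v i * \prod_(l < d) v l ^+ m l.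
Proof.
have := mevalX v (mnm_add (mnm1 i) m).
by rewrite mpolyXD mevalM mevalXU mevalX.
Qed.

Lemma kahan_increment_homogeneous (R : realType) (d : nat) (U : 'cV[R]_d -> R) :
  homogeneous_cubic U -> exists G, kahan_increment U G.
Proof.
move=> [p /allP p3 Up].
have -> : U = fun y => \sum_(m <- msupp p) mcoeff m p * \prod_i y i 0 ^+ m i.
  by apply/funext => y; rewrite Up mevalE.
apply: kahan_increment_sum => m /p3 /= /eqP.
move=> /mdegS_factor[i [m1 ->]] /mdegS_factor[j [m2 ->]] /mdegS_factor[k [m3 ->]].
move=> /eqP; rewrite mdeg_eq0 => /eqP ->.
eexists; apply: kahan_incrementZ.
have -> : (fun y : 'cV[R]_d => \prod_l y l 0 ^+
      mnm_add (mnm1 i) (mnm_add (mnm1 j) (mnm_add (mnm1 k) mnm0)) l)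
    = (fun y => y i 0 * y j 0 * y k 0).
  apply/funext => y; rewrite !(prodX_mnm1D (fun l => y l 0)).
  by rewrite big1 ?mulr1 ?mulrA// => l _; rewrite mnmE expr0.
exact: kahan_increment_monomial.
Qed.

Theorem theorem2 (R : realType) (d : nat) (Q M : 'M[R]_d)
  (U : 'cV[R]_d -> R) (h : R) (x x' : 'cV[R]_d)
  (Q_skew : Q^T = - Q) (M_sym : M^T = M) (U_cubic : homogeneous_cubic U) :
  let A := Q *m M in
  let f := fun y : 'cV[R]_d => Q *m grad U y in
  x' = mx_exp (h *: A) *m x
       + h *: (mx_phi (h *: A) *m
           (- (2^-1 *: f x) + 2 *: f (2^-1 *: (x + x')) - 2^-1 *: f x')) ->
  hamiltonian M U x' - hamiltonian M U x = U (x' - x).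
Proof.
move=> A f xE.
have [G [dUG UG]] := kahan_increment_homogeneous U_cubic.
have fE y : f y = Q *m G y.
  by congr (_ *m _); apply/colP => i; rewrite mxE; exact: derive_val.
set g := kahan_gradient G x x' in UG *.
pose S := h *: (mx_phi (h *: A) *m Q).
have x'E : x' = x + S *m (M *m x + g).
  rewrite {1}xE !fE mx_expE mulmxDl mul1mx -addrA; congr (_ + _).
  rewrite /S mulmxDr; congr (_ + _).
    by rewrite /A !(=^~ scalemxAl, =^~ scalemxAr) !mulmxA.
  rewrite -scalemxAl -mulmxA /g /kahan_gradient; congr (_ *: (_ *m _)).
  by rewrite !(mulmxDr, mulmxN, =^~ scalemxAr).
have quad := quadratic_energy_increment x g M_sym
  (etd_matrix_identity h Q_skew M_sym).
rewrite /= -/A -/S -x'E in quad.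
have DE : S *m (M *m x + g) = x' - x by rewrite [X in _ = X - _]x'E addrAC subrr add0r.
rewrite DE in quad.
rewrite /hamiltonian.
move: quad (UG x x'); rewrite -/g; lra.
Qed.
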